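(* Let $H$ be an Arf numerical semigroup. The set $\mathcal{A}(H)$ of all Arf numerical semigroups containing $H$ is a Frobenius variety.
   Context: $\mathbb{N}$ is the set of non-negative integers. A numerical semigroup is a subset $H\subseteq\mathbb{N}$ that contains $0$, is closed under addition, and has finite complement in $\mathbb{N}$. It is Arf if $2a-b\in H$ for all $a,b\in H$ with $a\ge b$. The Frobenius number $\mathrm{F}(H)$ is the largest element of $\mathbb{N}\setminus H$ (with $\mathrm{F}(\mathbb{N})=-1$). A nonempty family $\Psi$ of numerical semigroups is a Frobenius variety if: (1) $S,S'\in\Psi$ implies $S\cap S'\in\Psi$; and (2) $S\in\Psi$ and $S\ne\mathbb{N}$ imply $S\cup\{\mathrm{F}(S)\}\in\Psi$. *)

(* Defs.v *)
From mathcomp Require Import all_boot all_order all_algebra.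
From mathcomp Require Import boolp classical_sets functions cardinality.

Set Implicit Arguments.
Unset Strict Implicit.
Unset Printing Implicit Defensive.

Local Open Scope classical_set_scope.

Definition numerical_semigroup (H : set nat) : Prop :=
  [/\ H 0, (forall a b, H a -> H b -> H (a + b)) & finite_set (~` H)].

(* The subtraction on nat is exact here, since b <= a <= 2 * a. *)
Definition arf (H : set nat) : Prop :=
  forall a b, H a -> H b -> b <= a -> H (2 * a - b).

Definition arf_numerical_semigroup (H : set nat) : Prop :=
  numerical_semigroup H /\ arf H.

(* [xget] picks the largest gap when there is one (it is unique), and returns
   the default -1 otherwise; for a numerical semigroup H, whose complement is
   finite, the latter happens exactly when H = setT. *)
Definition frobenius_number (H : set nat) : int :=
  xget (-1)%R [set Posz n | n in [set n | ~ H n /\ forall m, ~ H m -> m <= n]].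

(* The singleton {F(S)} is taken in nat: it is the set of the n : nat whose
   image in int is F(S). *)
Definition frobenius_variety (Psi : set (set nat)) : Prop :=
  [/\ Psi !=set0,
      Psi `<=` [set S | numerical_semigroup S],
      (forall S S', Psi S -> Psi S' -> Psi (S `&` S')) &
      forall S, Psi S -> S <> setT ->
        Psi (S `|` [set n | Posz n = frobenius_number S])].

Definition arf_oversemigroups (H : set nat) : set (set nat) :=
  [set S | arf_numerical_semigroup S /\ H `<=` S].

(* Main.v *)
Require Import Defs.
From mathcomp Require Import all_boot all_order all_algebra.
From mathcomp Require Import boolp classical_sets functions cardinality.
From mathcomp Require Import zify.

Local Open Scope classical_set_scope.

(** Intersections keep all the conditions elementwise, and the complement of an intersection is a
    union of two finite sets ([arf_numerical_semigroupI]). For the other closure property, every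
    integer above F(S) lies in S, so adjoining F(S) gives a set containing everything from F(S) on;
    new sums and new values 2a - b land there ([arf_numerical_semigroupU1]). Containing H survives
    both operations, and H itself is a member. *)

Lemma finite_nat_set_max (A : set nat) :
  finite_set A -> A !=set0 -> exists2 n, A n & forall m, A m -> m <= n.
Proof.
move=> /finite_seqP[s ->] [x xs].
have exs : exists n, n \in s by exists x.
have ubs n : n \in s -> n <= \max_(i <- s) i.
  by move=> ns; apply: (@leq_bigmax_seq _ s xpredT id).
by case: (ex_maxnP exs ubs) => n ns nmax; exists n.
Qed.

(** Trades the integer-valued definition for a natural number [f]: the complement of a proper S is
    nonempty and finite, so it has a maximum and the default -1 is not returned. *)
Lemma frobenius_numberP (S : set nat) : finite_set (~` S) -> S <> setT ->
  exists f, [/\ frobenius_number S = Posz f, ~ S f & forall m, f < m -> S m].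
Proof.
move=> finS SNT.
have [|f nSf fmax] := finite_nat_set_max _ finS.
  by apply/set0P/eqP => S0; apply: SNT; rewrite -(setCK S) S0 setC0.
exists f; split=> //.
(* Two largest gaps bound each other, so [xget] has a single value to pick. *)
- apply: xget_unique; first by exists f.
  move=> _ [n [nSn nmax] <-]; congr Posz; apply/eqP.
  by rewrite eqn_leq fmax ?nmax.
- by move=> m fm; apply: contrapT => /fmax; rewrite leqNgt fm.
Qed.

Lemma arf_numerical_semigroupI (S T : set nat) :
  arf_numerical_semigroup S -> arf_numerical_semigroup T ->
  arf_numerical_semigroup (S `&` T).
Proof.
move=> [[S0 SD finS] arfS] [[T0 TD finT] arfT]; split; first split.
- by [].
- by move=> a b [Sa Ta] [Sb Tb]; split; [apply: SD|apply: TD].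
- by rewrite setCI finite_setU.
- by move=> a b [Sa Ta] [Sb Tb] ba; split; [apply: arfS|apply: arfT].
Qed.

(* If f is among the operands of a + b or 2a - b, the result is at least f,
   hence equal to f or in S. *)
Lemma arf_numerical_semigroupU1 (S : set nat) (f : nat) :
  arf_numerical_semigroup S -> (forall m, f < m -> S m) ->
  arf_numerical_semigroup (S `|` [set f]).
Proof.
move=> [[S0 SD finS] arfS] Sgt.
have Uge m : f <= m -> (S `|` [set f]) m.
  by rewrite leq_eqVlt => /orP[/eqP <-|/Sgt]; [right|left].
split; first split.
- by left.
- move=> a b [Sa|->] [Sb|->]; [left; exact: SD|apply: Uge; lia..].
- by apply: sub_finite_set finS; apply: subsetC; left.
- move=> a b [Sa|->] [Sb|->] ba; [left; exact: arfS|apply: Uge; lia..].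
Qed.

Theorem theorem3p19 (H : set nat) (hH : arf_numerical_semigroup H) :
  frobenius_variety (arf_oversemigroups H).
Proof.
split.
- by exists H; split.
- by move=> S [[]].
- move=> S T [hS HS] [hT HT]; split; first exact: arf_numerical_semigroupI.
  by move=> n Hn; split; [apply: HS|apply: HT].
- move=> S [hS HS] SNT; have [[_ _ finS] _] := hS.
  have [f [-> _ Sgt]] := frobenius_numberP _ finS SNT.
  (* Injectivity of [Posz] turns the adjoined set into a true singleton of naturals. *)
  have -> : [set n | Posz n = Posz f] = [set f].
    by apply/seteqP; split=> n /= => [[]|->].
  split; first exact: arf_numerical_semigroupU1.
  by move=> n /HS; left.
Qed.
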